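(* Let $f$ be an SGF on $\mathbb{R}^d$ or $\mathbb{Z}^d$ with covariance kernel $K$ and spectral measure $\mu$. Assume that there is $c>0$ such that $\mu[B(2\delta)]\le c\,\mu[B(\delta)]$ for all $\delta>0$, that $\liminf_{\delta\to0}\mu[B(\delta)]\,\delta^{-d}>0$, and that $K$ is eventually positive. Then there is $c'>0$ such that, for all $\delta>0$, $$\sup_u\mu[u+B(\delta)]\le c'\,\mu[B(\delta)].$$
   Context: An SGF on $\mathbb{R}^d$ or $\mathbb{Z}^d$ is a continuous (in the case of $\mathbb{R}^d$), centred, non-degenerate, stationary Gaussian field $f$. Its covariance kernel is $K(x)=\mathbb{E}[f(0)f(x)]$; its spectral measure $\mu$ is the unique non-negative, finite, symmetric measure with $K=\mathcal{F}[\mu]$, where $\mathcal{F}[\mu](x)=\int e^{-2\pi i\langle\lambda,x\rangle}d\mu(\lambda)$. It lives on $\mathbb{R}^d$ for fields on $\mathbb{R}^d$, and on the torus $\mathbb{R}^d/\mathbb{Z}^d$ for fields on $\mathbb{Z}^d$. $B(\delta)$ is the closed Euclidean ball of radius $\delta$ about the origin, and $u$ ranges over the space on which $\mu$ lives. $K$ is eventually positive if $K(x)>0$ for all $|x|$ sufficiently large. *)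

(* Defs.v *)
From HB Require Import structures.
From mathcomp Require Import all_boot all_order all_algebra.
From mathcomp Require Import generic_quotient ring_quotient complex.
From mathcomp Require Import all_classical all_reals all_analysis.

Set Implicit Arguments.
Unset Strict Implicit.
Unset Printing Implicit Defensive.

Import Order.TTheory GRing.Theory Num.Theory.
Import numFieldNormedType.Exports.

Local Open Scope classical_set_scope.
Local Open Scope quotient_scope.
Local Open Scope complex_scope.
Local Open Scope ring_scope.

Section Geometry.
Context (R : realType) (d : nat).

Definition dot (x y : 'rV[R]_d) : R := \sum_(i < d) x 0 i * y 0 i.

(* The library norm on ['rV[R]_d] is the sup norm; it induces the same topology,
   hence the same Borel sets, as this one. *)
Definition enorm (x : 'rV[R]_d) : R := Num.sqrt (dot x x).

Definition eball (r : R) : set 'rV[R]_d := [set x | enorm x <= r].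

Definition intvec (k : 'rV[int]_d) : 'rV[R]_d := map_mx intr k.

Definition int_lattice (x : 'rV[R]_d) : bool := x \is a mxOver Num.int.

Fact int_lattice_zmod_closed : zmod_closed int_lattice.
Proof.
split=> [|x y /mxOverP xZ /mxOverP yZ]; first by rewrite /int_lattice mxOver0 ?rpred0.
by apply/mxOverP => i j; rewrite !mxE rpredB.
Qed.
HB.instance Definition _ :=
  GRing.isZmodClosed.Build 'rV[R]_d int_lattice int_lattice_zmod_closed.

Definition torus : Type :=
  {ideal_quot (GRing.ZmodClosed.clone 'rV[R]_d int_lattice _)}.
HB.instance Definition _ := GRing.Zmodule.on torus.
HB.instance Definition _ := isPointed.Build torus 0.

Definition torus_pi (x : 'rV[R]_d) : torus := \pi x.
Definition torus_repr (l : torus) : 'rV[R]_d := repr l.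

Definition torus_open : set (set torus) := [set U | open (torus_pi @^-1` U)].

(* The projection of a Euclidean ball is the closed ball for the quotient
   distance, as the minimal norm of a representative is attained. *)
Definition torus_ball (r : R) : set torus := torus_pi @` eball r.

End Geometry.

Notation borel_space R d := (g_sigma_algebraType (@open 'rV[R]_d)).
Notation borel_torus R d := (g_sigma_algebraType (@torus_open R d)).

Section GaussianFields.
Context (R : realType) (d : measure_display) (T : measurableType d).
Context (P : probability T R).

(* Constants count as Gaussian. They are treated apart because
   [normal_prob m 0] is the uniform law on [0, 1], not the Dirac mass at m. *)
Definition gaussian_law (Y : T -> R) : Prop :=
  exists m s : R, forall A : set R, measurable A ->
    pushforward P Y A = if s == 0 then dirac m A else normal_prob m s A.

Context (X : zmodType).
Implicit Type f : X -> {RV P >-> R}.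

Definition gaussian_field f : Prop :=
  forall (n : nat) (x : 'I_n -> X) (a : 'I_n -> R),
    gaussian_law (fun w => \sum_(i < n) a i * f (x i) w).

Definition centred_field f : Prop := forall x, ('E_P[f x] = 0)%E.

Definition stationary_field f : Prop :=
  forall (n : nat) (x : n.-tuple X) (t : X) (A : set (n.-tuple R)),
    measurable A ->
    P [set w | A [tuple of [seq f (y + t) w | y <- x]]] =
    P [set w | A [tuple of [seq f y w | y <- x]]].

Definition nondegenerate_field f : Prop := (0 < 'V_P[f 0%R])%E.

Definition stationary_gaussian f : Prop :=
  [/\ gaussian_field f, centred_field f, stationary_field f & nondegenerate_field f].

Definition cov_kernel f (x : X) : R := fine ('E_P[(f 0 \* f x)%R])%E.

End GaussianFields.

Section SGF.
Context (R : realType) (dT : measure_display) (T : measurableType dT).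
Context (P : probability T R) (d : nat).

Definition sgf_space (f : 'rV[R]_d -> {RV P >-> R}) : Prop :=
  stationary_gaussian f /\
  {ae P, forall w, continuous (fun x : 'rV[R]_d => f x w)}.

Definition sgf_lattice (f : 'rV[int]_d -> {RV P >-> R}) : Prop :=
  stationary_gaussian f.

End SGF.

Section Fourier.
Context (R : realType).

Definition expi (t : R) : R[i] := cos t +i* sin t.

Definition cintegral (dL : measure_display) (L : measurableType dL)
    (mu : {measure set L -> \bar R}) (g : L -> R[i]) : R[i] :=
  Rintegral mu setT (fun l => complex.Re (g l)) +i*
  Rintegral mu setT (fun l => complex.Im (g l)).

Context (d : nat).

Definition fourier_space (mu : {measure set (borel_space R d) -> \bar R})
    (x : 'rV[R]_d) : R[i] :=
  cintegral mu (fun l => expi (- (2 * pi * dot l x))).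

(* As k is integral, the integrand does not depend on the representative. *)
Definition fourier_torus (mu : {measure set (borel_torus R d) -> \bar R})
    (k : 'rV[int]_d) : R[i] :=
  cintegral mu (fun l => expi (- (2 * pi * dot (torus_repr l) (intvec R k)))).

Definition spectral_space (K : 'rV[R]_d -> R)
    (mu : {finite_measure set (borel_space R d) -> \bar R}) : Prop :=
  (forall A : set (borel_space R d), measurable A ->
     mu ((fun l : 'rV[R]_d => - l) @^-1` A) = mu A) /\
  (forall x, (K x)%:C = fourier_space mu x).

Definition spectral_torus (K : 'rV[int]_d -> R)
    (mu : {finite_measure set (borel_torus R d) -> \bar R}) : Prop :=
  (forall A : set (borel_torus R d), measurable A ->
     mu ((fun l : torus R d => - l) @^-1` A) = mu A) /\
  (forall k, (K k)%:C = fourier_torus mu k).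

Definition eventually_positive_space (K : 'rV[R]_d -> R) : Prop :=
  exists r : R, forall x, r < enorm x -> 0 < K x.

Definition eventually_positive_lattice (K : 'rV[int]_d -> R) : Prop :=
  exists r : R, forall k, r < enorm (intvec R k) -> 0 < K k.

End Fourier.

(* [B r] stands for the closed ball of radius r about the origin of L. *)
Section Mass.
Context (R : realType) (L : zmodType) (B : R -> set L) (mu : set L -> \bar R).
Local Open Scope ereal_scope.

Definition doubling_at_origin : Prop :=
  exists2 c : R, (0 < c)%R &
    forall r : R, (0 < r)%R -> mu (B (2 * r)%R) <= c%:E * mu (B r).

Definition mass_lower_bound (d : nat) : Prop :=
  0 < limf_einf (fun r : R => mu (B r) * (r ^- d)%:E) (0%R)^'+.

Definition translates_dominated : Prop :=
  exists2 c : R, (0 < c)%R &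
    forall r : R, (0 < r)%R ->
      ereal_sup (range (fun u : L => mu [set (u + v)%R | v in B r]))
      <= c%:E * mu (B r).

End Mass.

(* Main.v *)
(* Let F be a nonnegative trigonometric polynomial with nonnegative coefficients
   w_k, at least 2^-d on B(delta) and with Gaussian decay at scale delta.  Then
     mu(u + B(delta)) <~ int (F(l - u) + F(l + u)) dmu
                       = 2 sum_k w_k cos(2 pi <u,k>) K(k) <= 2 sum_k w_k |K(k)|
                      <= 2 int F dmu + 4 K(0) sum_(k : K(k) <= 0) w_k.
   Doubling on dyadic shells gives int F dmu <~ mu(B(delta)); eventual positivity
   confines the last sum to bounded frequencies, where it is O(delta^d), hence
   O(mu(B(delta))) by the lower bound on the mass near 0.
   Taking for F the product over the coordinates of cos(pi s v_i)^(2 m^2), with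
   s = 1 / (6 m delta), only finite sums occur.  On the torus s = 1; on R^d the
   number m is taken so large, depending on delta, that the mass outside one
   period of F is at most mu(B(delta)). *)
Require Import Defs.
From HB Require Import structures.
From mathcomp Require Import all_boot all_order all_algebra.
From mathcomp Require Import generic_quotient ring_quotient complex.
From mathcomp Require Import all_classical all_reals all_analysis.
From mathcomp Require Import measurable_realfun ring lra zify.

Set Implicit Arguments.
Unset Strict Implicit.
Unset Printing Implicit Defensive.

Import Order.TTheory GRing.Theory Num.Theory.
Import numFieldNormedType.Exports.

Local Open Scope classical_set_scope.
Local Open Scope complex_scope.
Local Open Scope ring_scope.

(** * Elementary inequalities for sine, cosine and the exponential *)

Section Trigonometry.
Context {R : realType}.
Implicit Types x y : R.

Lemma sin_mean_value x : 0 <= x -> exists2 c, 0 <= c <= x & sin x = cos c * x.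
Proof.
move=> x0.
have [|c c0x] := @MVT_segment R sin cos 0 x x0 (fun y _ => is_derive_sin y).
  by apply: continuous_subspaceT; exact: continuous_sin.
by rewrite sin0 !subr0 => E; exists c => //; rewrite in_itv /= in c0x.
Qed.

Lemma norm_sin_le x : `|sin x| <= `|x|.
Proof.
wlog x0 : x / 0 <= x => [H|].
  have [/H//|/ltW x0] := leP 0 x.
  by rewrite -normrN -sinN -[leRHS]normrN H // oppr_ge0.
have [c _ ->] := sin_mean_value x0.
by rewrite normrM ler_piMl // cos_max.
Qed.

(** Half-angle formula [cos x = 1 - 2 sin(x/2)^2], with [|sin y| <= |y|]. *)
Lemma cos_ge_quadratic x : 1 - x ^+ 2 / 2 <= cos x.
Proof.
have -> : x = (x / 2) *+ 2 by rewrite mulr2n; lra.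
rewrite cos_mulr2n cos2sin2.
have := norm_sin_le (x / 2).
rewrite -(@ler_pXn2r _ 2) ?nnegrE // !real_normK ?num_real // !mulr2n.
rewrite -!mulr2n; nra.
Qed.

(** With [sin(x/2) = cos(c) x/2] for some [c <= x/2], the double angle gives [sin x = x cos(x/2)
    cos(c) >= x cos(x/2)^2], and [2 cos(x/2)^2 = 1 + cos x >= 1]. *)
Lemma sin_ge_half x : 0 <= x <= pi / 2 -> x / 2 <= sin x.
Proof.
move=> /andP[x0 xpi].
have y0 : 0 <= x / 2 by lra.
have [c /andP[c0 cy] sE] := sin_mean_value y0.
have yI : x / 2 \in `[0, pi] by rewrite in_itv /=; have := pi_gt0 R; lra.
have cI : c \in `[0, pi] by rewrite in_itv /=; have := pi_gt0 R; lra.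
have cosy : cos (x / 2) <= cos c.
  by rewrite leNgt ltr_cos // -leNgt.
have cos0 : 0 <= cos (x / 2) by apply: cos_ge0_pihalf; lra.
have cosx : 0 <= cos x by apply: cos_ge0_pihalf; lra.
have xE : x = (x / 2) *+ 2 by rewrite mulr2n; lra.
rewrite {1}xE cos_mulr2n in cosx.
rewrite {2}xE sin_mulr2n sE.
have c2 : 1 <= cos (x / 2) ^+ 2 *+ 2 by lra.
set a := cos (x / 2) in cosy cos0 c2 *; set b := cos c in cosy *.
have : 1 <= 2 * (a * b).
  apply: le_trans c2 _; rewrite -mulr_natl ler_pM2l // expr2.
  exact: ler_wpM2l.
move=> /(ler_wpM2r y0); rewrite mulr2n; lra.
Qed.

Lemma cos2_le_expR x : `|x| <= pi / 2 -> cos x ^+ 2 <= expR (- (x ^+ 2 / 4)).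
Proof.
move=> xpi; apply: le_trans (expR_ge1Dx _).
rewrite cos2sin2 lerD2l lerN2.
have := @sin_ge_half `|x|; rewrite normr_ge0 xpi => /(_ isT) H.
have -> : sin x ^+ 2 = sin `|x| ^+ 2.
  by case: (ger0P x) => //; rewrite sinN sqrrN.
rewrite -(real_normK (num_real x)).
have := normr_ge0 x; set a := `|x| in H *; set b := sin a in H * => a0.
by nra.
Qed.

Lemma bernoulli_inequality (x : R) n : 0 <= x <= 1 -> 1 - n%:R * x <= (1 - x) ^+ n.
Proof.
move=> /andP[x0 x1]; elim: n => [|n IH]; first by rewrite mul0r subr0 expr0.
have y0 : 0 <= 1 - x by lra.
rewrite exprS; apply: (@le_trans _ _ ((1 - x) * (1 - n%:R * x))); last exact: ler_wpM2l.
rewrite -natr1; have : 0 <= n%:R * x * x by rewrite !mulr_ge0.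
by set a := n%:R; nra.
Qed.

(** The [p]-th power of [y/p <= expR (y/p)], inverted. It trades Gaussian decay for polynomial decay
    of any prescribed order; at [p = 0] the right side is 1. *)
Lemma expRN_le_pow (y : R) p : 0 < y -> expR (- y) <= (p%:R / y) ^+ p.
Proof.
move=> y0; case: p => [|p]; first by rewrite expr0 expR_le1 oppr_le0 ltW.
have p0 : (0 : R) < p.+1%:R by rewrite ltr0n.
rewrite expRN -[_ ^+ _]invrK lef_pV2 ?posrE ?expR_gt0 ?invr_gt0 ?exprn_gt0 ?divr_gt0 //.
rewrite -exprVn invf_div.
have -> : expR y = expR (y / p.+1%:R) ^+ p.+1.
  by rewrite -expRM_natl mulrC divfK // gt_eqF.
rewrite lerXn2r ?nnegrE ?expR_ge0 ?divr_ge0 ?(ltW y0) ?(ltW p0) //.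
by apply: le_trans (expR_ge1Dx _); rewrite lerDr.
Qed.

Lemma cosD2pi_int x (k : int) : cos (x + 2 * pi * k%:~R) = cos x.
Proof.
have P : forall n y, cos (y + 2 * pi * n%:R) = cos y.
  move=> n y.
  have -> : y + 2 * pi * n%:R = y + (pi *+ 2) *+ n by rewrite -(mulr_natr (_ *+ 2)) -(mulr_natl pi).
  by rewrite (periodicn (@cosD2pi R)).
case: k => n; first exact: P.
by rewrite NegzE mulrNz -[in RHS](@subrK _ (2 * pi * n.+1%:R) x) P mulrN.
Qed.

End Trigonometry.

(** * Central binomial coefficients *)

(** The coefficients increase up to the middle; symmetry handles the upper half. *)
Lemma bin_central_max n j : ('C(2 * n, j) <= 'C(2 * n, n))%N.
Proof.
have up k m : (k + m <= n)%N -> ('C(2 * n, k) <= 'C(2 * n, k + m))%N.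
  elim: m => [|m IH] km; first by rewrite addn0.
  apply: leq_trans (IH _) _; first lia.
  have km1 : (0 < (k + m).+1)%N by [].
  rewrite addnS -(leq_pmul2l km1) mul_bin_left leq_mul2r; lia.
have [jn|nj] := leqP j n.
  by have := up j (n - j)%N; rewrite subnKC //; apply.
have [j2n|j2n] := leqP j (2 * n); last by rewrite bin_small.
rewrite -(bin_sub j2n); have := up (2 * n - j)%N (j - n)%N.
rewrite (_ : 2 * n - j + (j - n) = n)%N; last lia.
by apply; lia.
Qed.

(** Induction from [(n+1) C(2n+2,n+1) = 2 (2n+1) C(2n,n)] and [(2n+1)(2n+3) <= 4 (n+1)^2]. This is
    [C(2n,n) <= 4^n / sqrt(2n+1)] freed of the root. *)
Lemma bin_central_sqr n : ('C(2 * n, n) ^ 2 * (2 * n).+1 <= 16 ^ n)%N.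
Proof.
elim: n => [|n IH]; first by rewrite bin0.
have E : (n.+1 * 'C(2 * n.+1, n.+1) = 2 * (2 * n).+1 * 'C(2 * n, n))%N.
  have H1 := mul_bin_diag (2 * n.+1) n.
  have H2 := mul_bin_down (2 * n).+1 n.
  have E1 : (2 * n.+1).-1 = (2 * n).+1 by lia.
  have E2 : ((2 * n).+1.-1 = 2 * n)%N by lia.
  have E3 : ((2 * n).+1 - n = n.+1)%N by lia.
  rewrite E1 in H1; rewrite E2 E3 in H2.
  nia.
have n1 : (0 < n.+1 ^ 2)%N by rewrite expn_gt0.
rewrite -(leq_pmul2l n1) mulnA -expnMn E (expnS 16).
set C := 'C(2 * n, n) in IH *; set X := (16 ^ n)%N in IH *.
rewrite [leqLHS](_ : _ = (C ^ 2 * (2 * n).+1 * (4 * (2 * n).+1 * (2 * n.+1).+1))%N);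
  last by rewrite -!mulnn; lia.
apply: (@leq_trans (X * (4 * (2 * n).+1 * (2 * n.+1).+1))%N).
  by rewrite leq_mul2r IH orbT.
rewrite [leqRHS](_ : _ = (X * (16 * n.+1 ^ 2))%N); last by rewrite /X; lia.
by rewrite leq_mul2l; apply/orP; right; lia.
Qed.

(** * Powers of the cosine as exponential sums *)

Section ComplexExponential.
Context {R : realType}.
Implicit Types x y : R.

Lemma expiD x y : expi (x + y) = expi x * expi y.
Proof.
by apply/eqP; rewrite eq_complex /= cosD sinD eqxx /= addrC [cos x * sin y]mulrC [sin x * _]mulrC eqxx.
Qed.

Lemma expi0 : expi (0 : R) = 1.
Proof. by rewrite /expi cos0 sin0. Qed.

Lemma expi_sum (I : finType) (f : I -> R) :
  expi (\sum_i f i) = \prod_i expi (f i).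
Proof. exact: (big_morph _ expiD expi0). Qed.

Lemma expiMn x n : expi x ^+ n = expi (n%:R * x).
Proof.
elim: n => [|n IH]; first by rewrite mul0r expi0.
by rewrite exprS IH -expiD -(natr1 n) mulrDl mul1r addrC.
Qed.

Lemma cos_expi x : (cos x)%:C = (expi x + expi (- x)) / 2%:R.
Proof. by rewrite [LHS](ReJ_add (expi x)) /expi cosN sinN. Qed.

(** Binomial expansion of [((e^(ix) + e^(-ix)) / 2)^(2n)]: the even exponent makes every frequency
    [2n - 2j] even. *)
Lemma cos_pow_expi x n :
  (cos x ^+ (2 * n))%:C =
  \sum_(j < (2 * n).+1) ('C(2 * n, j)%:R / 4 ^+ n)%:C * expi ((n%:R - j%:R) * (2 * x)).
Proof.
rewrite rmorphXn /= cos_expi expr_div_n exprDn mulr_suml.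
apply: eq_bigr => j _; rewrite !expiMn -expiD rmorphM fmorphV rmorph_nat rmorphXn rmorph_nat /=.
rewrite [in RHS]mulrAC -[in LHS]mulr_natl exprM; congr (_ * expi _ / _ ^+ _).
  by rewrite natrB -1?ltnS // natrM; ring.
by rewrite -natrX.
Qed.

End ComplexExponential.

(** * The cosine kernel: expansion, size, and weight of its low frequencies *)

Section CosineKernel.
Context {R : realType} {d : nat}.
Implicit Types (v u : 'rV[R]_d) (s r : R) (n : nat).

Lemma dotC v u : dot v u = dot u v.
Proof. by apply: eq_bigr => i _; rewrite mulrC. Qed.

Lemma dotDl v u x : dot (v + u) x = dot v x + dot u x.
Proof. by rewrite /dot -big_split; apply: eq_bigr => i _; rewrite mxE mulrDl. Qed.

Lemma dotNl v x : dot (- v) x = - dot v x.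
Proof. by rewrite /dot -sumrN; apply: eq_bigr => i _; rewrite mxE mulNr. Qed.

Lemma dotZr s v x : dot v (s *: x) = s * dot v x.
Proof. by rewrite /dot mulr_sumr; apply: eq_bigr => i _; rewrite mxE mulrCA. Qed.

Lemma dot_ge0 v : 0 <= dot v v.
Proof. by apply: sumr_ge0 => i _; rewrite -expr2 sqr_ge0. Qed.

Lemma enorm_sqr v : enorm v ^+ 2 = dot v v.
Proof. by rewrite sqr_sqrtr // dot_ge0. Qed.

Lemma le_enorm_sqr v r : 0 <= r -> (enorm v <= r) = (dot v v <= r ^+ 2).
Proof.
by move=> r0; rewrite -enorm_sqr ler_pXn2r // nnegrE sqrtr_ge0.
Qed.

Lemma le_coord_enorm v i : `|v 0 i| <= enorm v.
Proof.
rewrite -(@ler_pXn2r _ 2) ?nnegrE ?sqrtr_ge0 // real_normK ?num_real // enorm_sqr.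
rewrite /dot (bigD1 i) //= -expr2 lerDl.
by apply: sumr_ge0 => j _; rewrite -expr2 sqr_ge0.
Qed.

(* At scale [s = 1 / (6 sqrt n delta)] this is close to a Gaussian of width
   [delta], and its expansion into cosines has nonnegative coefficients. *)
Definition cos_kernel s n v : R := \prod_(i < d) cos (pi * s * v 0 i) ^+ (2 * n).

Definition frequency n (g : {ffun 'I_d -> 'I_(2 * n).+1}) : 'rV[int]_d :=
  \row_i (n%:Z - (g i)%:Z).

(** Probability of [j] successes in [2n] fair trials. *)
Definition binomial_mass n (j : nat) : R := 'C(2 * n, j)%:R / 4 ^+ n.

Definition kernel_coef n (g : {ffun 'I_d -> 'I_(2 * n).+1}) : R :=
  \prod_i binomial_mass n (g i).

Lemma binomial_mass_ge0 n j : 0 <= binomial_mass n j.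
Proof. by rewrite divr_ge0 ?exprn_ge0. Qed.

Lemma kernel_coef_ge0 n g : 0 <= @kernel_coef n g.
Proof. by apply: prodr_ge0 => i _; exact: binomial_mass_ge0. Qed.

Lemma Re_sum (I : finType) (f : I -> R[i]) :
  complex.Re (\sum_i f i) = \sum_i complex.Re (f i).
Proof. by apply: (big_morph (@complex.Re R)) => // -[? ?] []. Qed.

(** Distributing the product over the coordinates turns the one-dimensional frequencies into vectors
    of [Z^d]; the real part keeps the cosines. *)
Lemma cos_kernel_expansion s n v :
  cos_kernel s n v = \sum_(g : {ffun 'I_d -> 'I_(2 * n).+1})
    kernel_coef g * cos (2 * pi * s * dot v (intvec R (frequency g))).
Proof.
have /(congr1 (@complex.Re R)) : (cos_kernel s n v)%:C =
    \sum_(g : {ffun 'I_d -> 'I_(2 * n).+1})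
     (kernel_coef g)%:C * expi (2 * pi * s * dot v (intvec R (frequency g))).
  rewrite rmorph_prod /=; under eq_bigr do rewrite cos_pow_expi.
  rewrite bigA_distr_bigA /=; apply: eq_bigr => g _.
  rewrite big_split /= rmorph_prod -expi_sum; congr (_ * expi _).
  rewrite /dot mulr_sumr; apply: eq_bigr => i _.
  by rewrite !mxE rmorphB /= -!pmulrn; ring.
rewrite Re_sum => /= ->; apply: eq_bigr => g _ /=.
by rewrite mul0r subr0.
Qed.

(** Adding the two shifts cancels the sine terms, so that integration in [v] involves only the
    cosine transform of the measure. *)
Lemma cos_kernel_shifts s n v u :
  cos_kernel s n (v - u) + cos_kernel s n (v + u) =
  \sum_(g : {ffun 'I_d -> 'I_(2 * n).+1}) 2 * kernel_coef g *
    cos (2 * pi * s * dot u (intvec R (frequency g))) *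
    cos (2 * pi * s * dot v (intvec R (frequency g))).
Proof.
rewrite !cos_kernel_expansion -big_split; apply: eq_bigr => g _ /=.
by rewrite !dotDl dotNl !mulrDr mulrN cosB cosD; ring.
Qed.

(** The even exponent gives period 1 rather than 2, as [cos(y)^2] is a function of [cos(2y)]. *)
Lemma cos_kernel_int_shift n v (k : 'rV[int]_d) :
  cos_kernel 1 n (v + intvec R k) = cos_kernel 1 n v.
Proof.
apply: eq_bigr => i _; rewrite !mulr1 !exprM; congr (_ ^+ _).
have E (y : R) : cos y ^+ 2 = (cos (2 * y) + 1) / 2.
  by rewrite mulr_natl cos_mulr2n mulr2n; lra.
rewrite !E !mxE (_ : 2 * (pi * _) = 2 * (pi * v 0 i) + 2 * pi * (k 0 i)%:~R); last by ring.
by rewrite cosD2pi_int.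
Qed.

Lemma cos_kernel_ge0 s n v : 0 <= cos_kernel s n v.
Proof. by apply: prodr_ge0 => i _; rewrite exprM exprn_ge0 // sqr_ge0. Qed.

Lemma cos_kernel_le1 s n v : cos_kernel s n v <= 1.
Proof.
by apply: prodr_ile1 => i _; rewrite exprM exprn_ge0 ?sqr_ge0 //= exprn_ile1 ?sqr_ge0.
Qed.

Lemma pi_le4 : pi <= 4 :> R.
Proof. by have := pihalf_lt2 R; lra. Qed.

(* Bernoulli's inequality applied to [cos y >= 1 - y^2 / 2]. *)
Lemma cos_kernel_lower s n v (delta : R) :
  0 <= s -> n%:R * (s * delta) ^+ 2 * 32 <= 1 -> enorm v <= delta ->
  2^-1 ^+ d <= cos_kernel s n v.
Proof.
move=> s0 nsd vd.
rewrite -[in leLHS](card_ord d) -prodr_const.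
apply: ler_prod => i _; rewrite invr_ge0 ler0n /=.
case: n nsd => [|n] nsd; first by rewrite muln0 expr0 invf_le1 // ler1n.
set t := v 0 i; have td : `|t| <= delta := le_trans (le_coord_enorm v i) vd.
set y := pi * s * t.
(* With [N = n.+1]: [N y^2 / 2 <= 8 N (s delta)^2 <= 8/32] since [pi <= 4]. Bernoulli at exponent
   [2N] then leaves at least [1 - 2/4]. *)
have yle : y ^+ 2 / 2 * n.+1%:R <= 4^-1.
  have : y ^+ 2 <= 16 * (s * delta) ^+ 2.
    rewrite -(real_normK (num_real y)) (_ : 16 = 4 ^+ 2); last by ring.
    rewrite -exprMn lerXn2r ?nnegrE //.
      by rewrite !mulr_ge0 // (le_trans _ td).
    rewrite /y !normrM (ger0_norm (pi_ge0 R)) (ger0_norm s0) -mulrA.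
    apply: ler_pM; rewrite ?pi_ge0 ?mulr_ge0 ?pi_le4 // ler_wpM2l //.
  have : (0 : R) <= n.+1%:R by [].
  set N := n.+1%:R in nsd * => N0 H.
  have := ler_wpM2r N0 H; lra.
have y2 : y ^+ 2 / 2 <= 4^-1.
  apply: le_trans yle; rewrite ler_peMr ?ler1n //.
  by rewrite divr_ge0 ?sqr_ge0.
have y0 : 0 <= y ^+ 2 / 2 by rewrite divr_ge0 ?sqr_ge0.
have c0 := cos_ge_quadratic y.
rewrite exprM -exprM.
apply: (@le_trans _ _ ((1 - y ^+ 2 / 2) ^+ (2 * n.+1))).
  apply: le_trans (bernoulli_inequality _ _); last by lra.
  rewrite natrM; lra.
by rewrite lerXn2r ?nnegrE //; lra.
Qed.

(** Each argument stays in [[-pi/2, pi/2]], where [cos(y)^2 <= expR (- y^2 / 4)]; since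
    [pi^2 / 4 >= 1], the exponents add up to the Euclidean norm. *)
Lemma cos_kernel_upper s n v :
  0 <= s -> (forall i, s * `|v 0 i| <= 2^-1) ->
  cos_kernel s n v <= expR (- (n%:R * (s * enorm v) ^+ 2)).
Proof.
move=> s0 sv.
apply: (@le_trans _ _ (\prod_(i < d) expR (- (n%:R * (s * v 0 i) ^+ 2)))).
  apply: ler_prod => i _; rewrite exprM exprn_ge0 ?sqr_ge0 //=.
  rewrite -mulrN expRM_natl lerXn2r ?nnegrE ?sqr_ge0 ?expR_ge0 //.
  apply: le_trans (cos2_le_expR _) _.
    rewrite -mulrA !normrM (ger0_norm (pi_ge0 R)) (ger0_norm s0).
    by rewrite ler_pM2l ?pi_gt0.
  rewrite ler_expR lerN2 -mulrA [(pi * _) ^+ 2]exprMn mulrAC ler_peMl ?sqr_ge0 //.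
  have : (2 : R) ^+ 2 <= pi ^+ 2 by rewrite lerXn2r ?nnegrE ?pi_ge0 ?pi_ge2.
  by lra.
rewrite -expR_sum ler_expR sumrN lerN2 exprMn enorm_sqr /dot !mulr_sumr.
by apply: ler_sum => i _; rewrite exprMn expr2.
Qed.

(** The square exponent [m^2] puts the decay [1 / sqrt(2 m^2 + 1)] of the central mass below the
    root-free [1/m]. *)
Lemma binomial_mass_le m j : (0 < m)%N -> binomial_mass (m ^ 2) j <= m%:R^-1.
Proof.
move=> m0; rewrite /binomial_mass ler_pdivrMr ?exprn_gt0 //.
apply: (@le_trans _ _ 'C(2 * m ^ 2, m ^ 2)%:R); first by rewrite ler_nat bin_central_max.
rewrite mulrC ler_pdivlMr ?ltr0n // -natrX -natrM ler_nat.
rewrite -(@leq_exp2r _ _ 2) // expnMn expnAC.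
by apply: leq_trans (bin_central_sqr _); rewrite leq_mul2l; apply/orP; right; lia.
Qed.

(** At most [2 b + 1] indices lie within [b] of the centre, each of mass at most [1/m]. *)
Lemma sum_central_mass_le m (b : R) : (0 < m)%N -> 0 <= b ->
  \sum_(j < (2 * m ^ 2).+1 | `|(m ^ 2)%:R - j%:R| <= b) binomial_mass (m ^ 2) j
  <= (2 * b + 1) / m%:R.
Proof.
move=> m0 b0; set n := (m ^ 2)%N.
apply: (@le_trans _ _ (\sum_(j < (2 * n).+1 | `|n%:R - j%:R| <= b) m%:R^-1)).
  by apply: ler_sum => j _; exact: binomial_mass_le.
rewrite sumr_const -[leLHS]mulr_natl ler_wpM2r //.
set q := Num.trunc b.
have qb : q%:R <= b by rewrite truncn_le.
apply: (@le_trans _ _ (2 * q + 1)%:R); last by rewrite natrD natrM lerD2r ler_pM2l.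
rewrite ler_nat.
have H : forall j : 'I_(2 * n).+1, `|n%:R - j%:R : R| <= b -> (n <= j + q)%N && (j <= n + q)%N.
  move=> j jb; have bq : b < q.+1%:R by exact: truncnS_gt.
  have := le_lt_trans jb bq; rewrite ltr_norml -natr1 => /andP[h1 h2].
  apply/andP; split; rewrite -ltnS -(ltr_nat R) -natr1 natrD; lra.
(* The indices embed into [2q + 1] consecutive integers from [n - q]; truncating [n - q] at 0 only
   moves the upper end beyond [n + q]. *)
rewrite -(size_iota (n - q) (2 * q + 1)) cardE -(size_map val).
apply: uniq_leq_size; first by rewrite map_inj_uniq ?enum_uniq //; exact: val_inj.
move=> _ /mapP[j + ->]; rewrite mem_enum => /H /andP[h1 h2].
by rewrite mem_iota /=; lia.
Qed.

(** The Euclidean ball of frequencies lies in a cube of half-side [r / s], over which the product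
    weights sum to a [d]-th power. *)
Lemma sum_low_frequency_le m s r : (0 < m)%N -> 0 < s -> 0 <= r ->
  \sum_(g : {ffun 'I_d -> 'I_(2 * m ^ 2).+1} |
          s * enorm (intvec R (frequency g)) <= r) kernel_coef g
  <= ((2 * (r / s) + 1) / m%:R) ^+ d.
Proof.
move=> m0 s0 r0; set n := (m ^ 2)%N.
have := @bigA_distr_big R 0 1 *%R +%R 'I_d 'I_(2 * n).+1
   (fun j => `|n%:R - j%:R| <= r / s) (fun _ j => binomial_mass n j).
rewrite prodr_const card_ord => E.
apply: (@le_trans _ _ ((\sum_(j < (2 * n).+1 | `|n%:R - j%:R| <= r / s) binomial_mass n j) ^+ d)).
  rewrite E big_mkcond [leRHS]big_mkcond /=.
  apply: ler_sum => g _; case: ifPn => [gr|_]; last first.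
    by case: ifP => // _; exact: kernel_coef_ge0.
  rewrite ifT //; apply/ffun_onP => i; rewrite unfold_in ler_pdivlMr // mulrC.
  apply: le_trans gr; rewrite ler_pM2l //.
  apply: le_trans (le_coord_enorm _ i).
  by rewrite !mxE rmorphB /= -!pmulrn.
have rs0 : 0 <= r / s by rewrite divr_ge0 // ltW.
apply: lerXn2r; rewrite ?nnegrE; last exact: sum_central_mass_le.
  by apply: sumr_ge0 => *; exact: binomial_mass_ge0.
by rewrite divr_ge0 // addr_ge0 // mulr_ge0.
Qed.

End CosineKernel.

(** * Integration against a finite measure *)

Section FiniteMeasure.
Context {R : realType} {dL : measure_display} {L : measurableType dL}.
Variable mu : {finite_measure set L -> \bar R}.
Local Notation mass A := (fine (mu A)).

Lemma massE A : measurable A -> mu A = (mass A)%:E.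
Proof. by move=> mA; rewrite fineK // fin_num_measure. Qed.

Lemma mass_le A B : measurable A -> measurable B -> A `<=` B -> mass A <= mass B.
Proof.
by move=> mA mB AB; rewrite -lee_fin -!massE // le_measure // inE.
Qed.

Lemma bounded_integrable (f : L -> R) (M : R) :
  measurable_fun setT f -> (forall x, `|f x| <= M) -> mu.-integrable setT (EFin \o f).
Proof.
move=> mf fM; apply: measurable_bounded_integrable => //.
  by rewrite ltey_eq fin_num_measure.
by exists M; split; [exact: num_real|move=> y My x _; exact: le_trans (fM x) (ltW My)].
Qed.

Lemma integrable_Rsum (I : Type) (s : seq I) (P : pred I) (f : I -> L -> R) :
  (forall i, mu.-integrable setT (EFin \o f i)) ->
  mu.-integrable setT (EFin \o (fun x => \sum_(i <- s | P i) f i x)).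
Proof.
move=> fi; have := @integrable_sum _ _ _ mu setT measurableT I s P
  (fun i => EFin \o f i) (fun i _ => fi i).
by apply: eq_integrable => // x _ /=; rewrite sumEFin.
Qed.

Lemma Rintegral_sum (I : Type) (s : seq I) (P : pred I) (f : I -> L -> R) :
  (forall i, mu.-integrable setT (EFin \o f i)) ->
  Rintegral mu setT (fun x => \sum_(i <- s | P i) f i x) =
  \sum_(i <- s | P i) Rintegral mu setT (f i).
Proof.
move=> fi; elim: s => [|i s IH].
  under eq_Rintegral do rewrite big_nil.
  by rewrite big_nil Rintegral_cst // mul0r.
under eq_Rintegral do rewrite big_cons.
rewrite big_cons; case: ifP => Pi; last by rewrite IH.
by rewrite RintegralD ?IH //; exact: integrable_Rsum.
Qed.

Lemma Rintegral_indic A : measurable A -> Rintegral mu setT (\1_A : L -> R) = mass A.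
Proof. by move=> mA; rewrite /Rintegral integral_indic // setIT. Qed.

Lemma integrableZl_fin (f : L -> R) (k : R) : mu.-integrable setT (EFin \o f) ->
  mu.-integrable setT (EFin \o (fun x => k * f x)).
Proof.
move=> fi; have := integrableZl measurableT k fi.
by apply: eq_integrable => // x _ /=; rewrite EFinM.
Qed.

(** * Mass of a translate bounded through the kernel sampled on a lattice of mesh [s] *)

Section SpectralBound.
Context {d : nat} (rep : L -> 'rV[R]_d) (K : 'rV[int]_d -> R) (s r : R).
Local Notation phase v k := (2 * pi * s * dot v (intvec R k)).
Hypotheses
  (mcos : forall k, measurable_fun setT (fun l => cos (phase (rep l) k)))
  (K_fourier : forall k, K k = Rintegral mu setT (fun l => cos (phase (rep l) k)))
  (K_pos : forall k, r < s * enorm (intvec R k) -> 0 < K k).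

Let cos_integrable k : mu.-integrable setT (EFin \o (fun l => cos (phase (rep l) k))).
Proof. by apply: (@bounded_integrable _ 1) => // x; exact: cos_max. Qed.

Let norm_K_le k : `|K k| <= mass setT.
Proof.
rewrite K_fourier; apply: le_trans (le_normr_Rintegral _ _) _ => //.
rewrite -[leRHS]mul1r -Rintegral_cst //; apply: le_Rintegral => // [||x _].
- by apply: (@bounded_integrable _ 1) => [|x]; [exact: measurableT_comp|rewrite normr_id cos_max].
- exact: finite_measure_integrable_cst.
- exact: cos_max.
Qed.

Lemma measurable_cos_kernel n : measurable_fun setT (fun l => cos_kernel s n (rep l)).
Proof.
under eq_fun do rewrite cos_kernel_expansion.
by apply: measurable_sum => g; apply: measurable_funM; [exact: measurable_cst|exact: mcos].
Qed.

Lemma Rintegral_cos_kernel n :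
  Rintegral mu setT (fun l => cos_kernel s n (rep l)) =
  \sum_g @kernel_coef R d n g * K (frequency g).
Proof.
under eq_Rintegral do rewrite cos_kernel_expansion.
rewrite Rintegral_sum => [|g]; last exact: integrableZl_fin.
by apply: eq_bigr => g _; rewrite RintegralZl // K_fourier.
Qed.

(* On the frequencies where [K] may be negative, [|K| <= K + 2 K(0)]. *)
Lemma mass_translate_le n (A : set L) (u : 'rV[R]_d) (a : R) :
  measurable A -> 0 <= a -> (forall l, A l -> a <= cos_kernel s n (rep l - u)) ->
  a * mass A <= 2 * (Rintegral mu setT (fun l => cos_kernel s n (rep l)) +
    2 * mass setT * \sum_(g : {ffun 'I_d -> 'I_(2 * n).+1} |
                       s * enorm (intvec R (frequency g)) <= r) kernel_coef g).
Proof.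
move=> mA a0 aF.
pose f (g : {ffun 'I_d -> 'I_(2 * n).+1}) l := 2 * kernel_coef g *
    cos (phase u (frequency g)) * cos (phase (rep l) (frequency g)).
have fi g : mu.-integrable setT (EFin \o f g) by exact: integrableZl_fin.
rewrite -Rintegral_indic // -RintegralZl //; last exact: integrable_indic.
(* The sum of the [f g] is the sum of the kernels shifted by [u] and [-u]: on [A] the first alone is
   at least [a], and elsewhere both are nonnegative. *)
apply: (@le_trans _ _ (Rintegral mu setT (fun l => \sum_g f g l))).
  apply: le_Rintegral => // [||l _].
  - exact/integrableZl_fin/integrable_indic.
  - exact: integrable_Rsum.
  - rewrite -cos_kernel_shifts. have [|] := boolP (l \in A); last first.
      by rewrite mulr0 addr_ge0 // cos_kernel_ge0.
    by rewrite inE mulr1 => /aF H; rewrite ler_wpDr // cos_kernel_ge0.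
rewrite Rintegral_sum // Rintegral_cos_kernel.
rewrite [\sum_(g | _ <= r) _]big_mkcond /= [2 * mass setT * _]mulr_sumr -big_split mulr_sumr /=.
apply: ler_sum => g _; rewrite RintegralZl // -K_fourier.
have := @kernel_coef_ge0 R d n g; move: (frequency g) (kernel_coef g) => k w w0.
have cK : cos (phase u k) * K k <= `|K k|.
  by rewrite (le_trans (ler_norm _)) // normrM ler_piMl // cos_max.
rewrite [leLHS](_ : _ = 2 * (w * (cos (phase u k) * K k))); last by ring.
rewrite ler_pM2l // [leRHS](_ : _ =
  w * (K k + 2 * mass setT * (s * enorm (intvec R k) <= r)%R%:R)); last first.
  by case: ifP => _; rewrite ?mulr0n ?mulr1n; ring.
rewrite ler_wpM2l // (le_trans cK) //.
have [_|/K_pos/ltW Kp] := leP (s * enorm (intvec R k)) r; last by rewrite mulr0 addr0 ger0_norm.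
have := norm_K_le k; rewrite mulr1; move: (mass setT) => M; rewrite ler_norml => /andP[? ?].
by rewrite ler_norml; apply/andP; split; lra.
Qed.

End SpectralBound.

(** * Summation over dyadic shells *)

Lemma geometric_half_le n : \sum_(j < n) (2^-1 : R) ^+ j <= 2.
Proof.
suff -> : \sum_(j < n) (2^-1 : R) ^+ j = 2 - 2 * 2^-1 ^+ n.
  by rewrite gerBl mulr_ge0 // exprn_ge0 // invr_ge0.
elim: n => [|n IH]; first by rewrite big_ord0 expr0; lra.
by rewrite big_ord_recr /= IH exprS; lra.
Qed.

(** The parts in [B 0] and off [B N] contribute at most [mass (B 0)] each. The shell between [B j]
    and [B (j+1)] contributes at most [D q^j c^(j+1) mass (B 0)], a geometric series of ratio
    [c q <= 1/2]. *)
Lemma Rintegral_shells_le (f : L -> R) (B : nat -> set L) (N : nat) (c q D : R) :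
  measurable_fun setT f -> (forall l, 0 <= f l <= 1) -> (forall j, measurable (B j)) ->
  0 <= c -> 0 <= q -> 0 <= D -> c * q <= 2^-1 ->
  (forall j, mass (B j.+1) <= c * mass (B j)) ->
  mass (~` B N) <= mass (B 0%N) ->
  (forall l j, B N l -> ~ B j l -> f l <= D * q ^+ j) ->
  Rintegral mu setT f <= (2 + 2 * D * c) * mass (B 0%N).
Proof.
move=> mf f01 mB c0 q0 D0 cq Bc BN fB.
pose g := fun l => (\1_(B 0%N) l : R) +
  (\sum_(j < N) (D * q ^+ j) * \1_(B j.+1) l + \1_(~` B N) l).
have shell_int (j : 'I_N) :
    mu.-integrable setT (EFin \o (fun l => (D * q ^+ j) * (\1_(B j.+1) l : R))).
  exact/integrableZl_fin/integrable_indic.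
have sum_int : mu.-integrable setT (EFin \o (fun l =>
    \sum_(j < N) (D * q ^+ j) * (\1_(B j.+1) l : R))).
  exact: integrable_Rsum.
have BCi : mu.-integrable setT (EFin \o (\1_(~` B N) : L -> R)).
  exact/integrable_indic/measurableC.
have sumC_int : mu.-integrable setT (EFin \o (fun l =>
    \sum_(j < N) (D * q ^+ j) * (\1_(B j.+1) l : R) + \1_(~` B N) l)).
  by have := integrableD measurableT sum_int BCi; apply: eq_integrable.
have g_int : mu.-integrable setT (EFin \o g).
  by have := integrableD measurableT (integrable_indic mu (mB 0%N)) sumC_int; apply: eq_integrable.
apply: (@le_trans _ _ (Rintegral mu setT g)).
  apply: le_Rintegral => // [|l _].
    apply: (@bounded_integrable _ 1) => // x.
    by have /andP[? ?] := f01 x; rewrite ger0_norm.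
  have s0 : 0 <= \sum_(j < N) (D * q ^+ j) * (\1_(B j.+1) l : R).
    by apply: sumr_ge0 => j _; rewrite !mulr_ge0 ?exprn_ge0.
  have /andP[_ f1] := f01 l.
  have in1 (A : set L) : A l -> \1_A l = 1 :> R by move=> Al; rewrite indicE mem_set.
  have [B0l|B0l] := pselect (B 0%N l).
    by rewrite /g in1 // ler_wpDr // addr_ge0.
  have [BNl|BNl] := pselect (B N l); last first.
    by rewrite /g (in1 (~` _)) // addrA ler_wpDl // addr_ge0.
  (* The least index of a set containing [l] is positive, as [l] is outside [B 0]; its predecessor
     indexes the shell whose term bounds [f l]. *)
  have exj : exists j, `[< B j l >] by exists N; apply/asboolP.
  case: (ex_minnP exj) => -[|j] /asboolP Bjl jmin; first by [].
  have jN : (j < N)%N by apply: jmin; apply/asboolP.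
  have nBj : ~ B j l by move=> /asboolP /jmin; rewrite ltnn.
  rewrite /g ler_wpDl // ler_wpDr //.
  rewrite (bigD1 (Ordinal jN)) //= in1 // mulr1.
  rewrite ler_wpDr ?fB //.
  by apply: sumr_ge0 => i _; rewrite !mulr_ge0 ?exprn_ge0.
have mBj j : mass (B j) <= c ^+ j * mass (B 0%N).
  elim: j => [|j IH]; first by rewrite expr0 mul1r.
  by apply: le_trans (Bc j) _; rewrite exprS -mulrA ler_wpM2l.
have b0 : 0 <= mass (B 0%N) by rewrite fine_ge0.
rewrite RintegralD ?RintegralD ?Rintegral_sum ?Rintegral_indic //;
  [|exact: measurableC|exact: integrable_indic].
apply: (@le_trans _ _ (mass (B 0%N) +
    (\sum_(j < N) 2^-1 ^+ j * (D * c * mass (B 0%N)) + mass (B 0%N)))).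
  rewrite lerD2l lerD // ler_sum // => j _.
  rewrite RintegralZl ?Rintegral_indic //; last exact: integrable_indic.
  apply: (@le_trans _ _ (D * q ^+ j * (c ^+ j.+1 * mass (B 0%N)))).
    by rewrite ler_wpM2l // mulr_ge0 // exprn_ge0.
  rewrite exprS (_ : _ * _ = (c * q) ^+ j * (D * c * mass (B 0%N))); last by rewrite exprMn; ring.
  by rewrite ler_wpM2r ?mulr_ge0 // lerXn2r // nnegrE ?mulr_ge0 // invr_ge0.
rewrite -mulr_suml.
have := ler_wpM2r (mulr_ge0 (mulr_ge0 D0 c0) b0) (geometric_half_le N).
lra.
Qed.

End FiniteMeasure.

(** * The estimate at one scale, common to both spaces *)

Section ScaleEstimate.
Context {R : realType} {dL : measure_display} {L : measurableType dL} {d : nat}.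
Variables (mu : {finite_measure set L -> \bar R}) (B : R -> set L).
Local Notation mass A := (fine (mu A)).

(** Free of [delta], [m] and [N]. The factor [2^d] inverts the lower bound on the kernel; the first
    summand comes from the shells, the second from the low frequencies. *)
Definition translate_const (c a r : R) p : R :=
  2 ^+ d * (2 * ((2 + 2 * (36 * p%:R) ^+ p * c) +
                 2 * mass setT * ((12 * r + 6) ^+ d / a))).

(** [rep] is the identity on [R^d] and picks a representative on the torus; [K] is the covariance
    kernel sampled on [s Z^d]. The vectors [v] stand for points modulo the period of the kernel:
    they keep its value while their norm and coordinates meet the conditions of the kernel
    bounds. *)
Lemma scale_estimate (rep : L -> 'rV[R]_d) (K : 'rV[int]_d -> R) (s r delta c a : R)
    (m p N : nat) (A : set L) (u : 'rV[R]_d) :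
  (forall k, measurable_fun setT (fun l => cos (2 * pi * s * dot (rep l) (intvec R k)))) ->
  (forall k, K k = Rintegral mu setT
     (fun l => cos (2 * pi * s * dot (rep l) (intvec R k)))) ->
  (forall k, r < s * enorm (intvec R k) -> 0 < K k) ->
  (forall x, measurable (B x)) ->
  (forall x, 0 < x -> mass (B (2 * x)) <= c * mass (B x)) ->
  0 <= r -> 0 < delta -> 0 < c -> c * 4^-1 ^+ p <= 2^-1 -> (0 < m)%N ->
  s * (6 * m%:R * delta) = 1 -> m%:R^-1 <= 6 * delta ->
  0 < a -> a * delta ^+ d <= mass (B delta) ->
  mass (~` B (2 ^+ N * delta)) <= mass (B delta) ->
  (forall l, B (2 ^+ N * delta) l -> exists v : 'rV[R]_d,
     [/\ cos_kernel s (m ^ 2) (rep l) = cos_kernel s (m ^ 2) v,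
         forall x, ~ B x l -> x <= enorm v & forall i, s * `|v 0 i| <= 2^-1]) ->
  measurable A ->
  (forall l, A l -> exists2 v : 'rV[R]_d,
     cos_kernel s (m ^ 2) (rep l - u) = cos_kernel s (m ^ 2) v & enorm v <= delta) ->
  mass A <= translate_const c a r p * mass (B delta).
Proof.
move=> mcos KE K_pos mB Bdouble r0 delta0 c0 cp m0 sE mdelta a0 Blow BN Brep mA Arep.
have m0R : (0 : R) < m%:R by rewrite ltr0n.
have s0 : 0 < s.
  by rewrite -(@pmulr_lgt0 _ (6 * m%:R * delta)) ?sE ?ltr01 // !mulr_gt0.
(* This value is independent of [m]. Being below [1/32] it yields the lower bound on [A]; its
   multiples by [4^j] govern the decay on the shells. *)
have sm : (m ^ 2)%:R * (s * delta) ^+ 2 = 36^-1.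
  have : (s * (6 * m%:R * delta)) ^+ 2 = 1 by rewrite sE expr1n.
  rewrite natrX; lra.
have lower l : A l -> 2^-1 ^+ d <= cos_kernel s (m ^ 2) (rep l - u).
  move=> /Arep[v -> vd]; apply: (cos_kernel_lower (ltW s0) _ vd).
  rewrite sm; lra.
have F_le : Rintegral mu setT (fun l => cos_kernel s (m ^ 2) (rep l)) <=
    (2 + 2 * (36 * p%:R) ^+ p * c) * mass (B delta).
  have -> : B delta = B (2 ^+ 0 * delta) by rewrite expr0 mul1r.
  (* In the largest ball but off [B (2^j delta)], the kernel is at most
     [expR (- 4^j / 36) <= (36 p)^p (4^-p)^j]; the order [p] is large enough to beat the doubling
     constant [c]. *)
  apply: (@Rintegral_shells_le _ _ _ mu _ (fun j => B (2 ^+ j * delta)) N c (4^-1 ^+ p)) => //.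
  - exact: measurable_cos_kernel.
  - by move=> l; rewrite cos_kernel_ge0 cos_kernel_le1.
  - exact: ltW.
  - by move=> j; rewrite exprS -mulrA; apply: Bdouble; rewrite mulr_gt0 // exprn_gt0.
  - by rewrite expr0 mul1r.
  move=> l j BNl /= nBj; have [v [-> vB vs]] := Brep l BNl.
  apply: le_trans (cos_kernel_upper _ (ltW s0) vs) _.
  have y0 : (0 : R) < 4 ^+ j / 36 by rewrite divr_gt0 // exprn_gt0.
  have -> : (36 * p%:R) ^+ p * 4^-1 ^+ p ^+ j = (p%:R / (4 ^+ j / 36)) ^+ p :> R.
    by rewrite exprAC -exprMn exprVn invf_div mulrCA mulrA.
  apply: le_trans (expRN_le_pow p y0); rewrite ler_expR lerN2.
  have -> : 4 ^+ j / 36 = (m ^ 2)%:R * (s * (2 ^+ j * delta)) ^+ 2 :> R.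
    have -> : 4 ^+ j = (2 ^+ j) ^+ 2 :> R by rewrite exprAC (_ : 4 = 2 ^+ 2) //; lra.
    rewrite -sm; move: (_ %:R) (2 ^+ j) => M t; ring.
  rewrite ler_wpM2l // lerXn2r ?nnegrE ?mulr_ge0 ?sqrtr_ge0 ?exprn_ge0 ?(ltW s0) ?(ltW delta0) //.
  by rewrite ler_wpM2l ?(ltW s0) // vB.
have W_le : \sum_(g : {ffun 'I_d -> 'I_(2 * m ^ 2).+1} |
    s * enorm (intvec R (frequency g)) <= r) kernel_coef g <=
    (12 * r + 6) ^+ d / a * mass (B delta).
  apply: le_trans (sum_low_frequency_le m0 s0 r0) _.
  have -> : r / s = r * (6 * m%:R * delta).
    by rewrite -[LHS]mulr1 -[X in _ * X = _]sE mulrA divfK ?gt_eqF.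
  (* As [r / s = 6 r m delta], the base is [12 r delta + 1/m], and [1/m <= 6 delta]; afterwards
     [delta^d <= mass (B delta) / a]. *)
  apply: (@le_trans _ _ (((12 * r + 6) * delta) ^+ d)).
    apply: lerXn2r; rewrite ?nnegrE.
    - by rewrite !(divr_ge0, addr_ge0, mulr_ge0) // ltW.
    - by rewrite !(addr_ge0, mulr_ge0) // ltW.
    - by rewrite mulrDl mul1r (_ : _ / _ = 12 * r * delta); [lra|field; rewrite gt_eqF].
  rewrite exprMn -[leRHS]mulrA.
  apply: ler_wpM2l; first by rewrite exprn_ge0 // addr_ge0 // mulr_ge0.
  by rewrite mulrC ler_pdivlMr // mulrC.
have h0 : (0 : R) < 2^-1 ^+ d by rewrite exprn_gt0.
have H := mass_translate_le mcos KE K_pos mA (ltW h0) lower.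
rewrite -(ler_pM2l h0); apply: le_trans H _.
have E (x b : R) : 2^-1 ^+ d * (2 ^+ d * x * b) = x * b.
  by rewrite exprVn -mulrA mulKf // expf_neq0 // pnatr_eq0.
rewrite /translate_const E -[leRHS]mulrA.
apply: ler_wpM2l => //; rewrite [leRHS]mulrDl; apply: lerD => //.
by rewrite -[leRHS]mulrA; apply: ler_wpM2l => //; rewrite mulr_ge0 // fine_ge0.
Qed.

End ScaleEstimate.

(** * Passage from small radii to all radii *)

Section Domination.
Context {R : realType}.
Local Open Scope ereal_scope.

Lemma exists_pow4_ge (c : R) : exists p, (c * 4^-1 ^+ p <= 2^-1)%R.
Proof.
have : (2 * c < (Num.trunc (2 * c)).+1%:R)%R by exact: truncnS_gt.
move: (Num.trunc _).+1 => q h; exists q; rewrite exprVn ler_pdivrMr ?exprn_gt0 //.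
have : (q%:R <= 4 ^+ q :> R)%R by rewrite -natrX ler_nat ltnW // ltn_expl.
lra.
Qed.

Lemma mass_lower_bound_near (T : zmodType) (B : R -> set T) (mu : set T -> \bar R) d :
  mass_lower_bound B mu d -> exists a r0, [/\ (0 < a)%R, (0 < r0)%R &
    forall r, (0 < r < r0)%R -> (a * r ^+ d)%:E <= mu (B r)].
Proof.
rewrite /mass_lower_bound limf_einfE => /ereal_sup_gt[_ [V V0 <-]] inf0.
have [a a0 aV] : exists2 a : R, (0 < a)%R & a%:E <= ereal_inf [set mu (B r) * (r ^- d)%:E | r in V].
  (* The infimum may be infinite; the constant 1 then serves. *)
  case: (ereal_inf _) inf0 => [a| |] // a0; first by exists a; rewrite ?lte_fin in a0 *.
  by exists 1%R => //; rewrite leey.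
case: V0 => r0 /= r00 r0V; exists a, r0; split => // r /andP[rp rr0].
have Vr : V r by apply: r0V => //=; rewrite sub0r normrN gtr0_norm.
have : a%:E <= mu (B r) * (r ^- d)%:E.
  by apply: le_trans aV _; apply: ereal_inf_lbound; exists r.
have rd : (0 < r ^+ d)%R by rewrite exprn_gt0.
rewrite -(@lee_pmul2r _ (r ^+ d)%:E) // ?lte_fin // -muleA -!EFinM.
by rewrite mulVf ?gt_eqF // mule1.
Qed.

(* Above a fixed scale [r1] the total mass suffices: take [M / e]. *)
Lemma translates_dominated_small (T : zmodType) (B : R -> set T) (mu : set T -> \bar R)
    (C M e r1 : R) :
  (0 <= C)%R -> (0 <= M)%R -> (0 < e)%R ->
  (forall u r, mu [set (u + v)%R | v in B r] <= M%:E) ->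
  (forall r, 0 <= mu (B r)) ->
  (forall r, (r1 <= r)%R -> e%:E <= mu (B r)) ->
  (forall u r, (0 < r < r1)%R -> mu [set (u + v)%R | v in B r] <= C%:E * mu (B r)) ->
  translates_dominated B mu.
Proof.
move=> C0 M0 e0 BM B0 Be BC; exists (C + M / e + 1)%R.
  by rewrite ltr_wpDl // addr_ge0 // divr_ge0 // ltW.
move=> r r0; apply: ge_ereal_sup => _ [u _ <-].
have [r1r|rr1] := leP r1 r; last first.
  apply: le_trans (BC u r _) _; first by rewrite r0.
  by rewrite lee_wpmul2r // lee_fin -addrA lerDl addr_ge0 // divr_ge0 // ltW.
apply: le_trans (BM u r) _.
have -> : M%:E = (M / e)%:E * e%:E by rewrite -EFinM divfK // gt_eqF.
apply: (@le_trans _ _ ((M / e)%:E * mu (B r))).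
  by rewrite lee_wpmul2l ?Be // lee_fin divr_ge0 // ltW.
by rewrite lee_wpmul2r // lee_fin addrAC lerDr addr_ge0.
Qed.

End Domination.

(** * Borel measurability of continuous functions *)

Section BorelMeasurability.
Context {R : realType}.

(** Open intervals generate the Borel sets of the line. The generating family [O] is abstract so as
    to cover both the vector space and the torus. *)
Lemma open_preimage_measurable (T : pointedType) (O : set (set T)) (f : T -> R) :
  (forall U : set R, open U -> O (f @^-1` U)) ->
  measurable_fun [set: g_sigma_algebraType O] f.
Proof.
move=> Of; apply: (measurability _ (RGenOpens.measurableE R)).
move=> _ [_ [x [y ->] <-]]; rewrite setTI; apply: sub_sigma_algebra.
by apply: Of; exact: interval_open.
Qed.

Lemma sublevel_measurable (T : pointedType) (O : set (set T)) (f : T -> R) (r : R) :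
  (forall U : set R, open U -> O (f @^-1` U)) ->
  measurable ([set x | f x <= r] : set (g_sigma_algebraType O)).
Proof.
move=> Of; have := open_preimage_measurable Of measurableT (measurable_itv `]-oo, r]).
by rewrite setTI (_ : _ @^-1` _ = [set x | f x <= r]) //; apply/seteqP; split => x /=; rewrite in_itv.
Qed.

Lemma continuous_Rsum (T : topologicalType) (I : Type) (s : seq I) (f : I -> T -> R) :
  (forall i, continuous (f i)) -> continuous (fun x => \sum_(i <- s) f i x).
Proof.
move=> fc; elim: s => [|i s IH].
  by under eq_fun do rewrite big_nil; move=> x; exact: cvg_cst.
under eq_fun do rewrite big_cons.
by move=> x; apply: cvgD; [exact: fc|exact: IH].
Qed.

Lemma continuous_dot d (k : 'rV[R]_d) : continuous (fun x : 'rV[R]_d => dot x k).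
Proof.
apply: continuous_Rsum => i x.
by apply: continuousM; [exact: coord_continuous|exact: cst_continuous].
Qed.

Lemma continuous_coordB d (u : 'rV[R]_d) i : continuous (fun x : 'rV[R]_d => (x - u) 0 i).
Proof.
under eq_fun do rewrite !mxE.
by move=> x; apply: continuousB; [exact: coord_continuous|exact: cst_continuous].
Qed.

Lemma continuous_enormB d (u : 'rV[R]_d) : continuous (fun x : 'rV[R]_d => enorm (x - u)).
Proof.
move=> x; apply: (@continuous_comp _ _ _ (fun x : 'rV[R]_d => dot (x - u) (x - u)) Num.sqrt).
  by apply: continuous_Rsum => i y; apply: continuousM; exact: continuous_coordB.
exact: sqrt_continuous.
Qed.

Lemma continuous_cos_dot d (t : R) (k : 'rV[R]_d) :
  continuous (fun x : 'rV[R]_d => cos (t * dot x k)).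
Proof.
move=> x; apply: (@continuous_comp _ _ _ (fun x : 'rV[R]_d => t * dot x k) cos).
  by apply: continuousM; [exact: cst_continuous|exact: continuous_dot].
exact: continuous_cos.
Qed.

End BorelMeasurability.

(** * Reduction to the estimate at one scale *)

Section Assembly.
Context {R : realType}.

(** The constant [a] is extracted from the lower limit, hence the order of quantifiers: [C] may
    depend on [a], but not on [u] or [r]. *)
Lemma translates_dominated_scales (T : zmodType) (B : R -> set T)
    (mu : set T -> \bar R) (d : nat) (M r1 : R) :
  (forall u r, mu [set (u + v)%R | v in B r] <= M%:E)%E ->
  (forall r, 0 <= mu (B r))%E -> (forall r, mu (B r) \is a fin_num) ->
  (forall r r', r <= r' -> (mu (B r) <= mu (B r'))%E) ->
  mass_lower_bound B mu d -> 0 < r1 ->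
  (forall a, 0 < a -> exists2 C, 0 <= C &
     forall u r, 0 < r < r1 -> ((a * r ^+ d)%:E <= mu (B r))%E ->
       (mu [set (u + v)%R | v in B r] <= C%:E * mu (B r))%E) ->
  translates_dominated B mu.
Proof.
move=> BM B0 Bfin Ble /mass_lower_bound_near[a [r0 [a0 r00 aB]]] r10 H.
have [C C0 BC] := H a a0.
have M0 : 0 <= M.
  rewrite -lee_fin; apply: le_trans (B0 1) _; apply: le_trans (BM 0 1).
  by rewrite (_ : [set 0 + v | v in B 1] = B 1) //;
     under eq_imagel do rewrite add0r; rewrite image_id.
(* Half the minimum lies strictly below [r0], so the lower bound holds at [r2] itself and [a r2^d]
   bounds the mass of every larger ball from below. *)
pose r2 := Num.min r1 r0 / 2.
have m0 : 0 < Num.min r1 r0 by rewrite lt_min r10 r00.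
have r20 : 0 < r2 by rewrite divr_gt0.
have r2lt : r2 < Num.min r1 r0 by rewrite ltr_pdivrMr // ltr_pMr // ltr1n.
move: r2lt; rewrite lt_min => /andP[r21 r2r0].
have e0 : 0 < a * r2 ^+ d by rewrite mulr_gt0 // exprn_gt0.
apply: (translates_dominated_small (r1 := r2) C0 M0 e0 BM B0).
  by move=> r r2r; apply: le_trans (Ble _ _ r2r); apply: aB; rewrite r20.
move=> u r /andP[rp rr2]; apply: BC; first by rewrite rp (lt_trans rr2).
by apply: aB; rewrite rp (lt_trans rr2).
Qed.

Lemma translate_const_ge0 dL (L : measurableType dL)
    (mu : {finite_measure set L -> \bar R}) d (c a r : R) p :
  0 <= c -> 0 <= a -> 0 <= r -> 0 <= @translate_const R dL L d mu c a r p.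
Proof.
move=> c0 a0 r0; have b0 : 0 <= 12 * r + 6 by rewrite addr_ge0 // mulr_ge0.
have M0 : 0 <= fine (mu setT) by rewrite fine_ge0.
rewrite /translate_const; do !(apply: mulr_ge0 || apply: addr_ge0 || apply: exprn_ge0) => //.
by rewrite invr_ge0.
Qed.

(** Real parts are compared; the cosine is even, so the sign of the phase drops out. *)
Lemma fourier_Re dL (L : measurableType dL) (mu : {measure set L -> \bar R})
    (t : L -> R) (k : R) :
  k%:C = cintegral mu (fun l => expi (- t l)) ->
  k = Rintegral mu setT (fun l => cos (t l)).
Proof. by case=> -> _; under eq_Rintegral do rewrite cosN. Qed.

End Assembly.

(** * Fields on [R^d] *)

Section Space.
Context {R : realType} {d : nat}.
Local Notation space := (borel_space R d).

Lemma space_translateE (u : 'rV[R]_d) r :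
  [set u + v | v in @eball R d r] = [set x | enorm (x - u) <= r].
Proof.
apply/seteqP; split => [_ [v vr <-] /=|x xr]; first by rewrite addrC addKr.
by exists (x - u) => //; rewrite addrC subrK.
Qed.

Lemma measurable_space_translate (u : 'rV[R]_d) r :
  measurable ([set u + v | v in @eball R d r] : set space).
Proof.
rewrite space_translateE; apply: sublevel_measurable => U oU.
by have /continuousP := @continuous_enormB R d u; apply.
Qed.

Lemma measurable_eball r : measurable (@eball R d r : set space).
Proof.
rewrite (_ : eball r = [set 0 + v | v in @eball R d r]).
  exact: measurable_space_translate.
by under eq_imagel do rewrite add0r; rewrite image_id.
Qed.

(** Continuity from above: the complements of the balls decrease to the empty set and [mu] is
    finite. *)
Lemma exists_large_ball (mu : {finite_measure set space -> \bar R}) (delta e : R) :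
  0 < delta -> 0 < e -> exists N, fine (mu (~` @eball R d (2 ^+ N * delta))) <= e.
Proof.
move=> delta0 e0.
pose F n : set space := ~` @eball R d (2 ^+ n * delta).
have mF n : measurable (F n) by apply: measurableC; exact: measurable_eball.
have F0 : \bigcap_n F n = set0.
  apply/seteqP; split => // x /= Fx; have [n hn] : exists n, enorm x <= 2 ^+ n * delta.
    exists (Num.trunc (enorm x / delta)).+1; rewrite -ler_pdivrMr //.
    have : enorm x / delta < (Num.trunc (enorm x / delta)).+1%:R by exact: truncnS_gt.
    move=> /ltW /le_trans; apply; rewrite -natrX ler_nat.
    by apply: ltnW; exact: ltn_expl.
  exact: (Fx n).
have : mu (F n) @[n --> \oo] --> mu (\bigcap_n F n).
  apply: nonincreasing_cvg_mu => //.
  - by rewrite ltey_eq fin_num_measure.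
  - by rewrite F0.
  move=> n m nm; apply/subsetPset => x; apply: contra_not => /= /le_trans; apply.
  by rewrite ler_pM2r // ler_eXn2l // ltr1n.
rewrite F0 measure0 => /fine_cvgP[_] /cvgrPdist_le /(_ e e0)[N _ /(_ N (leqnn N))] /=.
by rewrite sub0r normrN ger0_norm ?fine_ge0 // => H; exists N.
Qed.

Lemma space_dominated (K : 'rV[R]_d -> R) (mu : {finite_measure set space -> \bar R}) :
  spectral_space K mu -> doubling_at_origin (@eball R d) mu ->
  mass_lower_bound (@eball R d) mu d -> eventually_positive_space K ->
  translates_dominated (@eball R d) mu.
Proof.
move=> [_ KE] [c c0 Bc] Blow [r Kr].
(* The threshold of positivity may be negative; its positive part is still a threshold and keeps the
   constant nonnegative. *)
pose r' := Num.max r 0; have r'0 : 0 <= r' by rewrite le_max lexx orbT.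
have [p cp] := exists_pow4_ge c.
have fin A : measurable A -> mu A \is a fin_num by move=> mA; exact: fin_num_measure.
apply: (@translates_dominated_scales _ _ _ _ d (fine (mu setT)) 1 _ _ _ _ Blow ltr01).
- move=> u x; rewrite fineK ?fin //; apply: le_measure; rewrite ?inE //.
  exact: measurable_space_translate.
- by move=> x; exact: measure_ge0.
- by move=> x; apply: fin; exact: measurable_eball.
- move=> x y xy; apply: le_measure; rewrite ?inE; try exact: measurable_eball.
  by move=> z /= /le_trans; exact.
move=> a a0; exists (translate_const (d := d) mu c a r' p).
  by apply: translate_const_ge0 => //; exact: ltW.
move=> u delta /andP[delta0 _] adelta.
rewrite (massE _ (measurable_space_translate u delta)) (massE _ (measurable_eball delta)).
rewrite -EFinM lee_fin.
rewrite (massE _ (measurable_eball delta)) lee_fin in adelta.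
have e0 : 0 < fine (mu (@eball R d delta)).
  by apply: lt_le_trans adelta; rewrite mulr_gt0 // exprn_gt0.
have [N BN] := exists_large_ball mu delta0 e0.
(* The first summand gives [s 2^N delta <= 1/6], so the large ball stays within one period of the
   kernel; the second gives [1/m <= 6 delta]. *)
pose m := (2 ^ N + (Num.trunc (6 * delta)^-1).+1)%N.
have m0 : (0 < m)%N by rewrite /m addnS.
have m0R : 0 < m%:R :> R by rewrite ltr0n.
have md : m%:R^-1 <= 6 * delta.
  rewrite invf_ple ?posrE ?mulr_gt0 // ltW //.
  have : (6 * delta)^-1 < (Num.trunc (6 * delta)^-1).+1%:R by exact: truncnS_gt.
  by move=> /lt_le_trans; apply; rewrite ler_nat leq_addl.
have mN : 2 ^+ N <= m%:R :> R by rewrite -natrX ler_nat leq_addr.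
pose s := (6 * m%:R * delta)^-1.
have s0 : 0 < s by rewrite invr_gt0 !mulr_gt0.
have dotE (l : 'rV[R]_d) k : 2 * pi * s * dot l (intvec R k) = 2 * pi * dot l (s *: intvec R k).
  by rewrite dotZr mulrA.
apply: (@scale_estimate _ _ _ _ mu (@eball R d) id (fun k => K (s *: intvec R k))
          s r' delta c a m p N _ u) => //.
- move=> k; apply: open_preimage_measurable => U oU.
  by have /continuousP := @continuous_cos_dot R d (2 * pi * s) (intvec R k); apply.
- by move=> k; under eq_Rintegral do rewrite dotE; apply: fourier_Re; exact: KE.
- move=> k kr; apply: Kr; apply: (@le_lt_trans _ _ r'); first by rewrite le_max lexx.
  by rewrite /enorm dotZr dotC dotZr mulrA -expr2 sqrtrM ?sqr_ge0 // sqrtr_sqr gtr0_norm.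
- exact: measurable_eball.
- move=> x x0; have := Bc x x0; rewrite (massE _ (measurable_eball _)) [in leRHS]massE;
    last exact: measurable_eball.
  by rewrite -EFinM lee_fin.
- by rewrite mulVf // !mulf_neq0 // gt_eqF.
- move=> l Bl; exists l; split => // [x /negP|i]; first by rewrite -ltNge => /ltW.
  apply: (@le_trans _ _ (s * (2 ^+ N * delta))).
    by rewrite ler_pM2l // (le_trans (le_coord_enorm l i)).
  rewrite /s ler_pdivrMl ?mulr_gt0 // mulrC.
  have := ler_wpM2r (ltW delta0) mN; have : 0 <= m%:R * delta by rewrite mulr_ge0 // ltW.
  lra.
- exact: measurable_space_translate.
- by rewrite space_translateE => l /= lu; exists (l - u).
Qed.

End Space.

(** * Distance to the nearest integer *)

Section NearestInteger.
Context {R : realType}.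
Implicit Types t : R.

(** Ties round up, so the residue lies in [[-1/2, 1/2)]. *)
Definition round_int t : int := Num.floor (t + 2^-1).

Definition int_residue t : R := t - (round_int t)%:~R.

Lemma norm_int_residue_le t : `|int_residue t| <= 2^-1.
Proof.
rewrite /int_residue /round_int; have /andP[] := floor_itv (t + 2^-1).
move: (Num.floor _) => k; rewrite intrD1 => h1 h2.
by rewrite ler_norml; apply/andP; split; lra.
Qed.

(** A strictly closer integer would differ from [round_int t] by less than 1, hence equal it. *)
Lemma int_residue_min t (k : int) : `|int_residue t| <= `|t - k%:~R|.
Proof.
rewrite leNgt; apply/negP => h.
have h1 := norm_int_residue_le t.
have kE : k = round_int t.
  apply/eqP; rewrite -subr_eq0 -absz_eq0 -leqn0 -ltnS -(ltr_nat R) natr_absz intr_norm rmorphB /=.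
  have -> : k%:~R - (round_int t)%:~R = int_residue t - (t - k%:~R) :> R by rewrite /int_residue; lra.
  by apply: le_lt_trans (ler_normB _ _) _; lra.
by move: h; rewrite kE ltxx.
Qed.

(** The residue jumps at half-integers, but its absolute value is 1-Lipschitz: both points are
    compared with the integer nearest to one of them. *)
Lemma continuous_norm_int_residue : continuous (fun t => `|int_residue t|).
Proof.
have lip x y : `|int_residue x| - `|int_residue y| <= `|x - y|.
  rewrite lerBlDr; apply: le_trans (int_residue_min x (round_int y)) _.
  rewrite (_ : x - (round_int y)%:~R = (x - y) + int_residue y); last by rewrite /int_residue; ring.
  exact: ler_normD.
move=> x; apply/cvgrPdist_le => e e0; near=> y.
apply: (@le_trans _ _ `|x - y|); last by near: y; exact: cvgr_dist_le.
by rewrite ler_norml lip andbT lerNl opprB [leRHS]distrC lip.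
Unshelve. all: by end_near.
Qed.

End NearestInteger.

(** * Least representatives and balls on the torus *)

Section TorusQuotient.
Context {R : realType} {d : nat}.
Implicit Types x y : 'rV[R]_d.

Lemma torus_piD x y : torus_pi (x + y) = torus_pi x + torus_pi y.
Proof. by rewrite /torus_pi raddfD. Qed.

Lemma torus_reprK (l : torus R d) : torus_pi (torus_repr l) = l.
Proof. exact: reprK. Qed.

Lemma torus_piP x y : torus_pi x = torus_pi y <-> exists k, x = y + intvec R k.
Proof.
rewrite /torus_pi; split=> [/eqP|[k ->]].
  rewrite -Quotient.idealrBE => /mxOverP xy; exists (\row_i Num.floor ((x - y) 0 i)).
  apply/rowP => i; rewrite !mxE.
  have := xy 0 i; rewrite !mxE intrEfloor => /eqP ->; ring.
apply/eqP; rewrite -Quotient.idealrBE addrAC subrr add0r; apply/mxOverP => i j.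
by rewrite !mxE intr_int.
Qed.

(** The representative in the cube [[-1/2, 1/2)^d]; its norm is the least in the class of [x]. *)
Definition residue x : 'rV[R]_d := \row_i int_residue (x 0 i).

Lemma residueE x : x = residue x + intvec R (\row_i round_int (x 0 i)).
Proof. by apply/rowP => i; rewrite !mxE subrK. Qed.

Lemma torus_pi_residue x : torus_pi (residue x) = torus_pi x.
Proof.
by apply/esym/torus_piP; exists (\row_i round_int (x 0 i)); exact: residueE.
Qed.

Lemma dot_residue_le x : dot (residue x) (residue x) <= d%:R.
Proof.
rewrite -[leRHS]mul1r -[X in _ * X%:R]card_ord mulr_natr -sumr_const.
apply: ler_sum => i _; rewrite -expr2 mxE -(real_normK (num_real _)).
rewrite exprn_ile1 //; apply: le_trans (norm_int_residue_le _) _; lra.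
Qed.

Lemma enorm_residue_le x k : enorm (residue x) <= enorm (x + intvec R k).
Proof.
rewrite /enorm ler_wsqrtr //; apply: ler_sum => i _.
rewrite -!expr2 !mxE -[leLHS](real_normK (num_real _)) -[leRHS](real_normK (num_real _)).
rewrite lerXn2r ?nnegrE //.
by have := int_residue_min (x 0 i) (- k 0 i); rewrite mulrNz opprK.
Qed.

Lemma torus_ballP x r : torus_ball r (torus_pi x) <-> enorm (residue x) <= r.
Proof.
split=> [[y yr /torus_piP[k yE]]|xr].
  by apply: le_trans yr; rewrite yE; exact: enorm_residue_le.
by exists (residue x) => //; exact: torus_pi_residue.
Qed.

Lemma torus_translateE (u : torus R d) r :
  [set u + v | v in @torus_ball R d r] =
  [set l | enorm (residue (torus_repr l - torus_repr u)) <= r].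
Proof.
apply/seteqP; split=> l /=.
  case=> v vr <-; apply/torus_ballP; rewrite (_ : torus_pi _ = v) //.
  apply: (addrI u); rewrite -{1}(torus_reprK u) -torus_piD addrC subrK.
  exact: torus_reprK.
move=> /torus_ballP lr; exists (torus_pi (torus_repr l - torus_repr u)) => //.
by rewrite -{1}(torus_reprK u) -torus_piD addrC subrK torus_reprK.
Qed.

Lemma continuous_enorm_residue (u : 'rV[R]_d) :
  continuous (fun x => enorm (residue (x - u))).
Proof.
pose h i := fun x : 'rV[R]_d => `|int_residue ((x - u) 0 i)|.
have ch i : continuous (h i).
  move=> x; apply: (@continuous_comp _ _ _ (fun x : 'rV[R]_d => (x - u) 0 i) (fun t => `|int_residue t|)).
    exact: continuous_coordB.
  exact: continuous_norm_int_residue.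
have -> : (fun x => enorm (residue (x - u))) = (fun x => Num.sqrt (\sum_i h i x * h i x)).
  apply/funext => x; congr Num.sqrt; apply: eq_bigr => i _.
  by rewrite -!expr2 real_normK ?num_real // [residue _ _ _]mxE.
move=> x; apply: (@continuous_comp _ _ _ (fun x => \sum_i h i x * h i x) Num.sqrt).
  by apply: continuous_Rsum => i y; apply: continuousM; exact: ch.
exact: sqrt_continuous.
Qed.

Lemma torus_open_preimage (f : torus R d -> R) (g : 'rV[R]_d -> R) (U : set R) :
  continuous g -> (forall x, f (torus_pi x) = g x) -> open U -> torus_open (f @^-1` U).
Proof.
move=> /continuousP gc fg oU; rewrite /torus_open /=.
rewrite (_ : _ @^-1` _ = g @^-1` U); first exact: gc.
by apply/seteqP; split=> x /=; rewrite fg.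
Qed.

Lemma torus_repr_pi x : exists k, torus_repr (torus_pi x) = x + intvec R k.
Proof. by apply/torus_piP; rewrite torus_reprK. Qed.

(** Minimality in both directions: each residue is an integer translate of the other vector. *)
Lemma enorm_residue_shift x k : enorm (residue (x + intvec R k)) = enorm (residue x).
Proof.
apply/eqP; rewrite eq_le; apply/andP; split.
  apply: le_trans (enorm_residue_le _ (- k + \row_i (- round_int (x 0 i)))) _.
  rewrite le_eqVlt; apply/orP; left; apply/eqP; congr enorm.
  by apply/rowP => i; rewrite !mxE rmorphD !rmorphN /=; rewrite /int_residue; ring.
apply: le_trans (enorm_residue_le _ (k + \row_i (- round_int ((x + intvec R k) 0 i)))) _.
rewrite le_eqVlt; apply/orP; left; apply/eqP; congr enorm.
by apply/rowP => i; rewrite !mxE rmorphD !rmorphN /=; rewrite /int_residue; ring.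
Qed.

Lemma measurable_torus_translate (u : torus R d) r :
  measurable ([set u + v | v in @torus_ball R d r] : set (borel_torus R d)).
Proof.
rewrite torus_translateE; apply: sublevel_measurable => U.
apply: (@torus_open_preimage _ (fun x => enorm (residue (x - torus_repr u)))).
  exact: continuous_enorm_residue.
move=> x; have [k ->] := torus_repr_pi x.
by rewrite addrAC enorm_residue_shift.
Qed.

Lemma measurable_torus_ball r : measurable (@torus_ball R d r : set (borel_torus R d)).
Proof.
rewrite (_ : torus_ball r = [set 0 + v | v in @torus_ball R d r]).
  exact: measurable_torus_translate.
by under eq_imagel do rewrite add0r; rewrite image_id.
Qed.

(** * Fields on [Z^d] *)

(** With [s = 1] the admissible scales are [delta = 1 / (6 m)]. A radius [rho < 1/6] is rounded up
    to the nearest such scale, which is at most [2 rho], and doubling carries the bound from [delta]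
    back to [rho] at the cost of a factor [c]. *)
Lemma torus_dominated (K : 'rV[int]_d -> R)
    (mu : {finite_measure set (borel_torus R d) -> \bar R}) :
  spectral_torus K mu -> doubling_at_origin (@torus_ball R d) mu ->
  mass_lower_bound (@torus_ball R d) mu d -> eventually_positive_lattice K ->
  translates_dominated (@torus_ball R d) mu.
Proof.
move=> [_ KE] [c c0 Bc] Blow [r Kr].
pose r' := Num.max r 0; have r'0 : 0 <= r' by rewrite le_max lexx orbT.
have [p cp] := exists_pow4_ge c.
have fin A : measurable A -> mu A \is a fin_num by move=> mA; exact: fin_num_measure.
have sub_ball (x y : R) : x <= y -> @torus_ball R d x `<=` torus_ball y.
  by move=> xy _ [z zx <-]; exists z => //; exact: le_trans xy.
have Bc' (x : R) : 0 < x -> fine (mu (@torus_ball R d (2 * x))) <= c * fine (mu (@torus_ball R d x)).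
  move=> x0; have := Bc x x0; rewrite (massE _ (measurable_torus_ball _)).
  by rewrite [in leRHS]massE; [rewrite -EFinM lee_fin|exact: measurable_torus_ball].
have r10 : 0 < 6^-1 :> R by rewrite invr_gt0.
apply: (@translates_dominated_scales _ _ _ _ d (fine (mu setT)) 6^-1 _ _ _ _ Blow r10).
- move=> u x; rewrite fineK ?fin //; apply: le_measure; rewrite ?inE //.
  exact: measurable_torus_translate.
- by move=> x; exact: measure_ge0.
- by move=> x; apply: fin; exact: measurable_torus_ball.
- move=> x y xy; apply: le_measure; rewrite ?inE; try exact: measurable_torus_ball.
  exact: sub_ball.
(* Since [delta <= 2 rho] below, [a' delta^d <= a rho^d]. *)
move=> a a0; pose a' := a / 2 ^+ d.
have a'0 : 0 < a' by rewrite divr_gt0 // exprn_gt0.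
pose C := translate_const (d := d) mu c a' r' p.
have C0 : 0 <= C by apply: translate_const_ge0 => //; exact: ltW.
exists (C * c); first by rewrite mulr_ge0 // ltW.
move=> u rho /andP[rho0 rho6] arho.
rewrite (massE _ (measurable_torus_translate u rho)) (massE _ (measurable_torus_ball rho)).
rewrite -EFinM lee_fin.
rewrite (massE _ (measurable_torus_ball rho)) lee_fin in arho.
pose m := Num.trunc (6 * rho)^-1.
have /andP[m1 m2] : m%:R <= (6 * rho)^-1 < m.+1%:R.
  by apply: truncn_itv; rewrite invr_ge0 mulr_ge0 // ltW.
have m0 : (0 < m)%N.
  have : 1 < m.+1%:R :> R.
    by apply: le_lt_trans m2; rewrite -[leLHS]invr1 lef_pV2 ?posrE ?mulr_gt0 //; lra.
  by rewrite ltr1n ltnS.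
have m0R : 0 < m%:R :> R by rewrite ltr0n.
rewrite -[leRHS]mul1r ler_pdivlMr ?mulr_gt0 // in m1.
rewrite -[ltLHS]mul1r ltr_pdivrMr ?mulr_gt0 // -natr1 in m2.
pose delta := (6 * m%:R)^-1 : R.
have delta0 : 0 < delta by rewrite invr_gt0 mulr_gt0.
have sE : 1 * (6 * m%:R * delta) = 1 by rewrite mul1r mulfV // gt_eqF // mulr_gt0.
have rho_delta : rho <= delta.
  rewrite /delta -[leRHS]mul1r ler_pdivlMr ?mulr_gt0 //; lra.
have delta_rho : delta <= 2 * rho.
  rewrite /delta -[leLHS]mul1r ler_pdivrMr ?mulr_gt0 //.
  have : 0 <= rho * (m%:R - 1) by rewrite mulr_ge0 ?subr_ge0 ?ler1n // ltW.
  lra.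
have mass_delta : fine (mu (@torus_ball R d rho)) <= fine (mu (@torus_ball R d delta)).
  by apply: mass_le; [exact: measurable_torus_ball|exact: measurable_torus_ball|exact: sub_ball].
have Blow' : a' * delta ^+ d <= fine (mu (@torus_ball R d delta)).
  apply: le_trans mass_delta; apply: le_trans arho.
  rewrite /a' -mulrA ler_pM2l // ler_pdivrMl ?exprn_gt0 // -exprMn.
  by rewrite lerXn2r // nnegrE ?mulr_ge0 // ltW.
(* This makes [2^N delta >= d], while residues have norm at most [sqrt d]: the last ball is the
   whole torus and leaves no mass outside. *)
pose N := (6 * m * d)%N.
have N_all l : @torus_ball R d (2 ^+ N * delta) l.
  rewrite -(torus_reprK l); apply/torus_ballP.
  have dN : d%:R <= 2 ^+ N * delta.
    rewrite /delta ler_pdivlMr ?mulr_gt0 // -natrX -!natrM ler_nat mulnC ltnW //.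
    exact: ltn_expl.
  rewrite le_enorm_sqr; last by rewrite mulr_ge0 ?exprn_ge0 // ltW.
  apply: le_trans (dot_residue_le _) _; apply: (@le_trans _ _ (d%:R ^+ 2)).
    by rewrite -natrX ler_nat; case: (d) => // n; rewrite leq_pmulr.
  have Nd0 : 0 <= 2 ^+ N * delta by rewrite mulr_ge0 ?exprn_ge0 // ltW.
  by apply: lerXn2r => //; rewrite nnegrE.
apply: (@le_trans _ _ (fine (mu [set u + v | v in @torus_ball R d delta]))).
  apply: mass_le; try exact: measurable_torus_translate.
  by move=> _ [v vr <-]; exists v => //; exact: sub_ball vr.
apply: (@le_trans _ _ (C * fine (mu (@torus_ball R d delta)))); last first.
  rewrite -[leRHS]mulrA; apply: ler_wpM2l => //; apply: le_trans (Bc' rho rho0).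
  by apply: mass_le; [exact: measurable_torus_ball|exact: measurable_torus_ball|exact: sub_ball].
have cos_kernel_residue n (x : 'rV[R]_d) : cos_kernel 1 n (residue x) = cos_kernel 1 n x.
  by rewrite [in RHS](residueE x) cos_kernel_int_shift.
apply: (@scale_estimate _ _ _ _ mu (@torus_ball R d) (@torus_repr R d) K
          1 r' delta c a' m p N _ (torus_repr u)) => //.
- move=> k; apply: open_preimage_measurable => U.
  apply: (@torus_open_preimage _ (fun x => cos (2 * pi * 1 * dot x (intvec R k)))).
    exact: continuous_cos_dot.
  move=> x; have [j ->] := torus_repr_pi x.
  (* Changing the representative shifts the phase by a multiple of [2 pi], so the cosine descends
     from a continuous function. *)
  have [n nE] : exists n : int, dot (intvec R j) (intvec R k) = n%:~R.
    exists (\sum_i j 0 i * k 0 i); rewrite rmorph_sum /=.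
    by apply: eq_bigr => i _; rewrite !mxE rmorphM.
  by rewrite dotDl nE mulrDr mulr1 cosD2pi_int.
- by move=> k; apply: fourier_Re; rewrite mulr1; exact: KE.
- move=> k; rewrite mul1r => kr; apply: Kr; apply: le_lt_trans kr.
  by rewrite le_max lexx.
- exact: measurable_torus_ball.
- by rewrite /delta invfM mulVKf // pnatr_eq0.
- rewrite (_ : ~` _ = set0) ?measure0 ?fine_ge0 //.
  by apply/seteqP; split => // l; apply; exact: N_all.
(* Periodicity keeps the kernel value, minimality of the norm compares it with the balls, and the
   coordinates are at most [1/2]. *)
- move=> l _; exists (residue (torus_repr l)); split => [|x|i].
  + by rewrite cos_kernel_residue.
  + rewrite -{1}(torus_reprK l) => nB; rewrite leNgt; apply/negP => /ltW h.
    by apply: nB; exact/torus_ballP.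
  + by rewrite mul1r mxE norm_int_residue_le.
- exact: measurable_torus_translate.
- by rewrite torus_translateE => l /= lu; exists (residue (torus_repr l - torus_repr u)).
Qed.

End TorusQuotient.

Theorem proposition1p8 (R : realType) (dT : measure_display)
    (T : measurableType dT) (P : probability T R) (d : nat) (d_gt0 : (0 < d)%N) :
  (forall (f : 'rV[R]_d -> {RV P >-> R})
          (mu : {finite_measure set (borel_space R d) -> \bar R}),
     sgf_space f ->
     spectral_space (cov_kernel f) mu ->
     doubling_at_origin (@eball R d) mu ->
     mass_lower_bound (@eball R d) mu d ->
     eventually_positive_space (cov_kernel f) ->
     translates_dominated (@eball R d) mu) /\
  (forall (f : 'rV[int]_d -> {RV P >-> R})
          (mu : {finite_measure set (borel_torus R d) -> \bar R}),
     sgf_lattice f ->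
     spectral_torus (cov_kernel f) mu ->
     doubling_at_origin (@torus_ball R d) mu ->
     mass_lower_bound (@torus_ball R d) mu d ->
     eventually_positive_lattice (cov_kernel f) ->
     translates_dominated (@torus_ball R d) mu).
Proof.
by split=> f mu _; [exact: space_dominated|exact: torus_dominated].
Qed.
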